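(* Let $G$ be a simple connected undirected graph with $n\ge 2$ vertices and average resistance degrees $\overline{R}_1,\dots,\overline{R}_n$. Then $$2\min_{i\ne j}\sqrt{\overline{R}_i\,\overline{R}_j}\;\le\; E_R(G)\;\le\; 2\max_{i\ne j}\sqrt{\overline{R}_i\,\overline{R}_j}.$$
   Context: For a connected graph $G$ with vertices $v_1,\dots,v_n$, Laplacian matrix $L$ (degree matrix minus adjacency matrix) and Moore-Penrose inverse $L^\dagger=(l^\dagger_{ij})$, the resistance distance is $r_{ij}=l^\dagger_{ii}+l^\dagger_{jj}-2l^\dagger_{ij}$, and the resistance distance matrix is $R(G)=(r_{ij})_{n\times n}$. The resistance degrees are $R_i=\sum_{j=1}^n r_{ij}$, the second resistance degrees are $T_i=\sum_{j=1}^n r_{ij}R_j$, and the average resistance degrees are $\overline{R}_i=T_i/R_i$. The resistance energy $E_R(G)$ is the sum of the absolute values of the eigenvalues of $R(G)$, counted with multiplicity. The minimum and maximum are over $i,j\in\{1,\dots,n\}$ with $i\ne j$. *)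

(* Defs.v *)
From mathcomp Require Import all_boot all_order all_algebra.
From mathcomp Require Import complex.

Set Implicit Arguments.
Unset Strict Implicit.
Unset Printing Implicit Defensive.

Import Order.TTheory GRing.Theory Num.Theory.
Local Open Scope ring_scope.

Section MoorePenrose.
Variable R : realFieldType.

Definition moore_penrose m n (A : 'M[R]_(m, n)) (X : 'M[R]_(n, m)) : bool :=
  [&& A *m X *m A == A, X *m A *m X == X,
      (A *m X)^T == A *m X & (X *m A)^T == X *m A].

Lemma mulmx_trmx_eq0 m n (A : 'M[R]_(m, n)) : A *m A^T = 0 -> A = 0.
Proof.
move=> A0; apply/matrixP => i j; rewrite mxE.
have := congr1 (fun B : 'M_m => B i i) A0; rewrite !mxE => /eqP.
rewrite psumr_eq0; last by move=> k _; rewrite mxE -expr2 sqr_ge0.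
by move=> /allP/(_ j (mem_index_enum _)); rewrite mxE -expr2 sqrf_eq0 => /eqP.
Qed.

Lemma row_free_gram_unit m n (A : 'M[R]_(m, n)) :
  row_free A -> A *m A^T \in unitmx.
Proof.
move=> fA; rewrite -row_free_unit -kermx_eq0; apply/eqP.
apply: (row_free_inj fA); rewrite mul0mx; apply: mulmx_trmx_eq0.
by rewrite trmx_mul mulmxA -(mulmxA _ A) mulmx_ker mul0mx.
Qed.

(* Full-rank factorisation A = C F gives F^T (F F^T)^-1 (C^T C)^-1 C^T. *)
Lemma moore_penrose_exists m n (A : 'M[R]_(m, n)) :
  exists X, moore_penrose A X.
Proof.
have: A = col_base A *m row_base A by rewrite mulmx_base.
have: row_base A *m (row_base A)^T \in unitmx.
  exact/row_free_gram_unit/row_base_free.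
have: (col_base A)^T *m col_base A \in unitmx.
  rewrite -{2}[col_base A]trmxK; apply: row_free_gram_unit.
  by rewrite /row_free mxrank_tr; have := col_base_full A.
move: (\rank A) (col_base A) (row_base A) => r C F uC uF defA.
pose P := invmx (F *m F^T); pose Q := invmx (C^T *m C).
have PT : P^T = P by rewrite trmx_inv trmx_mul trmxK.
have QT : Q^T = Q by rewrite trmx_inv trmx_mul trmxK.
pose X := F^T *m P *m Q *m C^T.
have AX : A *m X = C *m Q *m C^T.
  by rewrite defA /X !mulmxA -(mulmxA C F) -(mulmxA C _ P) mulmxV // mulmx1.
have XA : X *m A = F^T *m P *m F.
  by rewrite defA /X !mulmxA -(mulmxA _ C^T C) -(mulmxA _ Q) mulVmx // mulmx1.
exists X; apply/and4P; split; apply/eqP.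
- by rewrite AX {1}defA !mulmxA -(mulmxA _ C^T C) -(mulmxA C Q) mulVmx // mulmx1.
- by rewrite XA /X !mulmxA -(mulmxA _ F F^T) -(mulmxA F^T P) mulVmx // mulmx1.
- by rewrite AX !trmx_mul trmxK QT mulmxA.
- by rewrite XA !trmx_mul trmxK PT mulmxA.
Qed.

Lemma moore_penrose_unique m n (A : 'M[R]_(m, n)) X Y :
  moore_penrose A X -> moore_penrose A Y -> X = Y.
Proof.
move=> /and4P[/eqP AXA /eqP XAX /eqP AXT /eqP XAT].
move=> /and4P[/eqP AYA /eqP YAY /eqP AYT /eqP YAT].
have eAX : A *m X = A *m Y.
  have /(congr1 trmx) : A *m Y *m (A *m X) = A *m X by rewrite mulmxA AYA.
  by rewrite trmx_mul AXT AYT mulmxA AXA.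
have eXA : X *m A = Y *m A.
  have /(congr1 trmx) : X *m A *m (Y *m A) = X *m A.
    by rewrite -mulmxA (mulmxA A) AYA.
  by rewrite trmx_mul XAT YAT -mulmxA (mulmxA A) AXA.
by rewrite -XAX -mulmxA eAX mulmxA eXA YAY.
Qed.

Definition mpinv m n (A : 'M[R]_(m, n)) : 'M[R]_(n, m) :=
  xchoose (moore_penrose_exists A).

Lemma mpinvP m n (A : 'M[R]_(m, n)) : moore_penrose A (mpinv A).
Proof. exact: xchooseP. Qed.

End MoorePenrose.

(* The eigenvalues are taken in R[i], so that no symmetry of A is presupposed;
   roots of the characteristic polynomial, repeated by multiplicity. *)
Section Energy.
Variable R : rcfType.

Definition eigenvalues n (A : 'M[R]_n) : seq R[i] :=
  sval (closed_field_poly_normal (char_poly (map_mx (real_complex R) A))).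

Lemma char_poly_eigenvalues n (A : 'M[R]_n) :
  char_poly (map_mx (real_complex R) A) =
  \prod_(z <- eigenvalues A) ('X - z%:P).
Proof.
rewrite /eigenvalues; case: closed_field_poly_normal => s /= {1}->.
by rewrite (monicP (char_poly_monic _)) scale1r.
Qed.

Definition energy n (A : 'M[R]_n) : R :=
  \sum_(z <- eigenvalues A) ComplexField.Normc.normc z.

End Energy.

Section Resistance.
Variables (R : rcfType) (n : nat) (e : rel 'I_n).

Definition adjacency : 'M[R]_n := \matrix_(i, j) (e i j)%:R.

Definition degree_mx : 'M[R]_n := diag_mx (\row_i #|[set j | e i j]|%:R).

Definition laplacian : 'M[R]_n := degree_mx - adjacency.

Definition resistance_mx : 'M[R]_n :=
  let Ld := mpinv laplacian in
  \matrix_(i, j) (Ld i i + Ld j j - Ld i j *+ 2).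

Definition resistance_deg (i : 'I_n) : R := \sum_j resistance_mx i j.

Definition resistance_deg2 (i : 'I_n) : R :=
  \sum_j resistance_mx i j * resistance_deg j.

Definition avg_resistance_deg (i : 'I_n) : R :=
  resistance_deg2 i / resistance_deg i.

Definition resistance_energy : R := energy resistance_mx.

End Resistance.

(* Extrema of f i j over i != j; the starting value of the fold is one of the
   values, so these are true extrema as soon as 1 < n (junk value 0 otherwise). *)
Section OffDiagonal.
Variables (R : realDomainType) (n : nat) (f : 'I_n -> 'I_n -> R).

Definition offdiag_vals : seq R :=
  [seq f p.1 p.2 | p : 'I_n * 'I_n in [pred p | p.1 != p.2]].

Definition min_offdiag : R :=
  \big[Num.min/head 0 offdiag_vals]_(x <- offdiag_vals) x.

Definition max_offdiag : R :=
  \big[Num.max/head 0 offdiag_vals]_(x <- offdiag_vals) x.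

Lemma mem_offdiag_vals x :
  reflect (exists i j, i != j /\ x = f i j) (x \in offdiag_vals).
Proof.
apply: (iffP imageP) => [[[i j]] /= ij ->|[i [j [ij ->]]]].
  by exists i, j.
by exists (i, j).
Qed.

Lemma offdiag_vals_head : (1 < n)%N -> head 0 offdiag_vals \in offdiag_vals.
Proof.
move=> n1; have: f (Ordinal (ltnW n1)) (Ordinal n1) \in offdiag_vals.
  by apply/mem_offdiag_vals; exists (Ordinal (ltnW n1)), (Ordinal n1).
by case: offdiag_vals => //= a s _; rewrite mem_head.
Qed.

Lemma min_offdiag_le i j : i != j -> min_offdiag <= f i j.
Proof.
move=> ij; apply: (@bigmin_inf_seq _ _ _ _ _ (f i j)) => //.
by apply/mem_offdiag_vals; exists i, j.
Qed.

Lemma min_offdiag_attained :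
  (1 < n)%N -> exists i j, i != j /\ min_offdiag = f i j.
Proof.
move=> n1; apply/mem_offdiag_vals; rewrite /min_offdiag big_seq.
elim/big_ind: _ => [|x y xs ys|x //]; first exact: offdiag_vals_head.
by rewrite minEle; case: ifP.
Qed.

Lemma le_max_offdiag i j : i != j -> f i j <= max_offdiag.
Proof.
move=> ij; apply: (@bigmax_sup_seq _ _ _ _ _ (f i j)) => //.
by apply/mem_offdiag_vals; exists i, j.
Qed.

Lemma max_offdiag_attained :
  (1 < n)%N -> exists i j, i != j /\ max_offdiag = f i j.
Proof.
move=> n1; apply/mem_offdiag_vals; rewrite /max_offdiag big_seq.
elim/big_ind: _ => [|x y xs ys|x //]; first exact: offdiag_vals_head.
by rewrite maxEle; case: ifP.
Qed.

End OffDiagonal.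

(* Main.v *)
Require Import Defs.
From mathcomp Require Import all_boot all_order all_algebra.
From mathcomp Require Import complex ring spectral.

(** Let A be the resistance distance matrix and X the Moore-Penrose inverse of
    the Laplacian L.  Connectedness makes constants the kernel of L, hence X is
    positive definite on vectors with coordinate sum zero
    ([mpinv_laplacian_gt0]).  Therefore the off-diagonal entries of A are
    positive ([resistance_mx_gt0]), and, for a vector x with coordinate sum
    zero, x A x^T = - 2 x X x^T, so that A is negative definite on a hyperplane
    ([resistance_neg_def_sum0]).

    A real symmetric matrix that is negative definite on a hyperplane has at
    most one nonnegative eigenvalue ([spectral_nonneg_unique]).  The trace of A
    is zero, so there is exactly one positive eigenvalue r, all others are
    negative, and the energy is 2 r.  Being the largest eigenvalue, r is a
    maximum of the Rayleigh quotient; this yields a positive eigenvector y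
    ([energy_perron]).

    Write y_i = R_i x_i with R_i the resistance degrees.  If x_p and x_q are the
    two largest values of x, the zero diagonal of A gives
    r R_p x_p <= T_p x_q and r R_q x_q <= T_q x_p, where T_i are the second
    resistance degrees; multiplying, r is at most the geometric mean of the
    average resistance degrees at p and q ([perron_le_sqrt]).  The two smallest
    values give the lower bound ([perron_ge_sqrt]). *)

Set Implicit Arguments.
Unset Strict Implicit.
Unset Printing Implicit Defensive.

Import Order.TTheory GRing.Theory Num.Theory.
Local Open Scope ring_scope.

(** * Quadratic forms, similarity and finite index sets *)

Lemma quad_form_sum (R : comNzRingType) (n : nat) (A : 'M[R]_n) (x : 'rV[R]_n) :
  (x *m A *m x^T) 0 0 = \sum_i \sum_j x 0 i * A i j * x 0 j.
Proof.
rewrite mxE exchange_big /=; apply: eq_bigr => j _.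
by rewrite !mxE big_distrl.
Qed.

(** Negative definiteness of the quadratic form of [A] on the hyperplane of
    vectors with coordinate sum zero. *)
Definition neg_def_sum0 (R : numDomainType) (n : nat) (A : 'M[R]_n) : Prop :=
  forall x : 'rV[R]_n, \sum_i x 0 i = 0 -> x != 0 -> (x *m A *m x^T) 0 0 < 0.

Lemma char_poly_similar (F : fieldType) (n : nat) (P A : 'M[F]_n) :
  P \in unitmx -> char_poly (invmx P *m A *m P) = char_poly A.
Proof.
move=> uP; pose Q := map_mx polyC P; pose Q' := map_mx polyC (invmx P).
have Q'Q : Q' *m Q = 1%:M by rewrite -map_mxM mulVmx // map_mx1.
rewrite /char_poly.
have -> : char_poly_mx (invmx P *m A *m P) = Q' *m char_poly_mx A *m Q.
  rewrite /char_poly_mx !map_mxM mulmxBr mulmxBl; congr (_ - _).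
  by rewrite mul_mx_scalar -scalemxAl Q'Q scalemx1.
by rewrite !det_mulmx mulrAC -det_mulmx Q'Q det1 mul1r.
Qed.

Lemma exists_neq (n : nat) (k : 'I_n) : (1 < n)%N -> exists l : 'I_n, l != k.
Proof.
move=> n1; have [k0|kN0] := eqVneq (k : nat) 0%N.
  by exists (Ordinal n1); rewrite -val_eqE /= k0.
by exists (Ordinal (ltnW n1)); rewrite -val_eqE /= eq_sym.
Qed.

(** * Real symmetric matrices diagonalised over R[i] *)

Section RealSymmetric.
Variables (R : rcfType) (n : nat) (A : 'M[R]_n).
Hypothesis A_sym : A^T = A.

Local Notation toC := (real_complex R).
Local Notation AC := (map_mx toC A).
Local Open Scope sesquilinear_scope.

(** The rows of [P] form an orthonormal basis of complex eigenvectors; the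
    eigenvalues [D i] are real. *)
Lemma real_sym_spectral :
  exists (P : 'M[R[i]]_n) (D : 'I_n -> R),
    [/\ P \in unitmx, invmx P = P ^t*,
        AC = invmx P *m diag_mx (\row_i toC (D i)) *m P
      & perm_eq (eigenvalues A) [seq toC (D i) | i <- enum 'I_n]].
Proof.
have hA : AC \is hermsymmx.
  apply: realsym_hermsym.
    apply/is_hermitianmxP; rewrite expr0 scale1r; apply/matrixP => i j.
    by rewrite !mxE -{1}A_sym mxE.
  by apply/mxOverP => i j; rewrite mxE; apply/complex_realP; exists (A i j).
pose P := spectralmx AC; pose D i := complex.Re (spectral_diag AC 0 i).
have uP : P \in unitmx by apply: spectral_unit.
have eD : spectral_diag AC = \row_i toC (D i).
  apply/rowP => i; rewrite mxE RRe_real //.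
  exact: (mxOverP (hermitian_spectral_diag_real hA)).
have eA : AC = invmx P *m diag_mx (\row_i toC (D i)) *m P.
  by rewrite -eD; apply/orthomx_spectralP/hermitian_normalmx.
exists P, D; split => //; first by rewrite invmx_unitary ?spectral_unitarymx.
apply: prod_XsubC_eq; rewrite -char_poly_eigenvalues eA char_poly_similar //.
rewrite char_poly_trig ?diag_mx_is_trig // big_map big_enum /=.
by apply: eq_bigr => i _; rewrite !mxE eqxx.
Qed.

Lemma energy_spectral (D : 'I_n -> R) :
  perm_eq (eigenvalues A) [seq toC (D i) | i <- enum 'I_n] ->
  energy A = \sum_i `|D i|.
Proof.
move=> eD; rewrite /energy (perm_big _ eD) big_map big_enum /=.
by apply: eq_bigr => i _; rewrite /= expr0n addr0 sqrtr_sqr.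
Qed.

(** The Hermitian form of a real symmetric matrix splits over the real and
    imaginary parts: the cross terms cancel by symmetry. *)
Lemma herm_form_real (z : 'rV[R[i]]_n)
    (x := map_mx (@complex.Re R) z) (y := map_mx (@complex.Im R) z) :
  (z *m AC *m z ^t*) 0 0 = toC ((x *m A *m x^T) 0 0 + (y *m A *m y^T) 0 0).
Proof.
have ez i : z 0 i = toC (x 0 i) + 'i%C * toC (y 0 i).
  by rewrite !mxE -complexE.
have ezc i : (z ^t*) i 0 = toC (x 0 i) - 'i%C * toC (y 0 i).
  rewrite !mxE; case: (z 0 i) => a b; apply/eqP.
  by rewrite eq_complex; apply/andP; split; apply/eqP => /=; ring.
have -> : (z *m AC *m z ^t*) 0 0 = \sum_i \sum_j z 0 i * AC i j * (z ^t*) j 0.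
  by rewrite mxE exchange_big /=; apply: eq_bigr => j _; rewrite mxE big_distrl.
rewrite !quad_form_sum -big_split /=.
(* a collects the real parts, b the imaginary parts of the summands. *)
pose a i j := x 0 i * A i j * x 0 j + y 0 i * A i j * y 0 j.
pose b i j := y 0 i * A i j * x 0 j - x 0 i * A i j * y 0 j.
transitivity (\sum_i \sum_j (toC (a i j) + 'i%C * toC (b i j))).
  apply: eq_bigr => i _; apply: eq_bigr => j _.
  rewrite ez ezc /a /b [AC i j]mxE !(rmorphB, rmorphD, rmorphM) /=.
  by have := sqr_i R; move: 'i%C => I I2; ring: I2.
transitivity (toC (\sum_i \sum_j a i j) + 'i%C * toC (\sum_i \sum_j b i j)).
  rewrite !rmorph_sum mulr_sumr -big_split; apply: eq_bigr => i _ /=.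
  by rewrite !rmorph_sum mulr_sumr -big_split.
have -> : \sum_i \sum_j b i j = 0.
  under eq_bigr do rewrite sumrB.
  rewrite sumrB [X in X - _]exchange_big /= -sumrB big1 // => i _.
  rewrite -sumrB big1 // => j _.
  have -> : A j i = A i j by rewrite -{1}A_sym mxE.
  ring.
rewrite rmorph0 mulr0 addr0; apply: congr1.
by apply: eq_bigr => i _; rewrite -big_split.
Qed.

Section Diagonalised.
Variables (P : 'M[R[i]]_n) (D : 'I_n -> R).
Hypotheses (P_unit : P \in unitmx) (P_inv : invmx P = P ^t*).
Hypothesis A_diag : AC = invmx P *m diag_mx (\row_i toC (D i)) *m P.

Lemma trace_spectral : \tr A = \sum_i D i.
Proof.
apply: (@complexI R); rewrite -trace_map_mx A_diag -mulmxA mxtrace_mulC.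
rewrite -mulmxA mulmxV // mulmx1 mxtrace_diag rmorph_sum.
by apply: eq_bigr => i _; rewrite mxE.
Qed.

Lemma herm_form_spectral (w : 'rV[R[i]]_n) :
  (w *m P *m AC *m (w *m P) ^t*) 0 0 = \sum_i toC (D i) * `|w 0 i| ^+ 2.
Proof.
rewrite trmx_mul map_mxM A_diag -P_inv !mulmxA.
rewrite -(mulmxA w) mulmxV // mulmx1 -(mulmxA _ P) mulmxV // mulmx1.
rewrite mul_mx_diag mxE; apply: eq_bigr => i _.
by rewrite !mxE normCK mulrAC mulrC.
Qed.

Lemma norm_spectral (w : 'rV[R[i]]_n) :
  (w *m P *m (w *m P) ^t*) 0 0 = \sum_i `|w 0 i| ^+ 2.
Proof.
rewrite trmx_mul map_mxM -P_inv !mulmxA -(mulmxA w) mulmxV // mulmx1.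
by rewrite mxE; apply: eq_bigr => i _; rewrite !mxE normCK.
Qed.

Lemma herm_form_lt0 (z : 'rV[R[i]]_n) :
  neg_def_sum0 A ->
  \sum_i z 0 i = 0 -> z != 0 -> (z *m AC *m z ^t*) 0 0 < 0.
Proof.
move=> negA sz zN0; rewrite herm_form_real -(rmorph0 toC) ltcR.
set x := map_mx _ _; set y := map_mx _ _.
have ReD : {morph @complex.Re R : u v / u + v} by case=> a b [].
have ImD : {morph @complex.Im R : u v / u + v} by case=> a b [].
have sx : \sum_i x 0 i = 0.
  under eq_bigr do rewrite mxE.
  by rewrite -(big_morph _ ReD (erefl : complex.Re (0 : R[i]) = 0)) ?sz.
have sy : \sum_i y 0 i = 0.
  under eq_bigr do rewrite mxE.
  by rewrite -(big_morph _ ImD (erefl : complex.Im (0 : R[i]) = 0)) ?sz.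
have le0 (u : 'rV[R]_n) : \sum_i u 0 i = 0 -> (u *m A *m u^T) 0 0 <= 0.
  move=> su; have [->|uN0] := eqVneq u 0; last exact/ltW/negA.
  by rewrite !mul0mx mxE.
have [x0|xN0] := eqVneq x 0; last by rewrite ltr_wnDr ?negA ?le0.
have [y0|yN0] := eqVneq y 0; last by rewrite ltr_wnDl ?negA ?le0.
case/eqP: zN0; apply/rowP => i.
move/rowP/(_ i): x0; move/rowP/(_ i): y0; rewrite !mxE.
by case: (z 0 i) => a b /= -> ->.
Qed.

(** The span of two eigenvectors with nonnegative eigenvalues would meet the
    hyperplane of coordinate sum zero in a nonzero vector. *)
Lemma spectral_nonneg_unique :
  neg_def_sum0 A ->
  forall k l, 0 <= D k -> 0 <= D l -> k = l.
Proof.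
move=> negA k l Dk Dl; apply/eqP/negPn/negP => kl.
(* The coordinate sums of the eigenvectors, introduced through an equation so
   that entrywise rewriting does not unfold them. *)
have [s sE] : exists s : 'cV_n, s = P *m const_mx 1 by eexists.
(* In the eigenbasis, the coordinate sum of w P is w *m s; the vector w is
   supported on k and l and is killed by s. *)
have [w [wN0 ws wkl]] : exists w : 'rV[R[i]]_n,
    [/\ w != 0, w *m s = 0 & forall i, i != k -> i != l -> w 0 i = 0].
  have [sl0|slN0] := eqVneq (s l 0) 0.
    exists (delta_mx 0 l); split.
    - by apply/rV0Pn; exists l; rewrite !mxE !eqxx oner_eq0.
    - by rewrite -rowE; apply/rowP => i; rewrite (ord1 i) mxE sl0 mxE.
    - by move=> i _ /negbTE il; rewrite mxE il andbF.
  exists (s l 0 *: delta_mx 0 k - s k 0 *: delta_mx 0 l); split.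
  - move: (s l 0) (s k 0) slN0 => a b aN0; apply/rV0Pn; exists k.
    by rewrite !mxE !eqxx (negbTE kl) mulr1 mulr0 subr0.
  - rewrite mulmxBl -!scalemxAl -!rowE; apply/rowP => i.
    by rewrite (ord1 i) !mxE mulrC subrr.
  - move=> i /negbTE ik /negbTE il.
    by rewrite !mxE ik il andbF !mulr0 subrr.
have := herm_form_lt0 negA (z := w *m P); rewrite herm_form_spectral.
have -> : \sum_i (w *m P) 0 i = 0.
  transitivity ((w *m P *m const_mx 1 : 'cV_1) 0 0).
    by rewrite mxE; apply: eq_bigr => i _; rewrite [const_mx _ _ _]mxE mulr1.
  by rewrite -mulmxA -sE ws mxE.
have wPN0 : w *m P != 0.
  by apply: contra_neq wN0 => wP0; rewrite -(mulmxK P_unit w) wP0 mul0mx.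
move=> /(_ erefl wPN0)/lt_geF/negbT/negP; apply.
apply: sumr_ge0 => i _.
have ge0 j : 0 <= D j -> 0 <= toC (D j) * `|w 0 j| ^+ 2.
  by move=> Dj; rewrite mulr_ge0 ?exprn_ge0 // -(rmorph0 toC) lecR.
have [->|ik] := eqVneq i k; first exact: ge0.
have [->|il] := eqVneq i l; first exact: ge0.
by rewrite wkl // normr0 expr0n mulr0.
Qed.

(** A vector whose Rayleigh quotient reaches an upper bound of the spectrum is
    an eigenvector for that bound. *)
Lemma rayleigh_max_eigenvector (r : R) (y : 'rV[R]_n) :
  (forall i, D i <= r) -> r * (y *m y^T) 0 0 <= (y *m A *m y^T) 0 0 ->
  y *m A = r *: y.
Proof.
move=> Dr ray; have [w wP] : exists w, w *m P = map_mx toC y.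
  by exists (map_mx toC y *m invmx P); rewrite mulmxKV.
have yc : (map_mx toC y) ^t* = map_mx toC y^T.
  by apply/matrixP => i j; rewrite !mxE; apply: conjc_real.
have := herm_form_spectral w; rewrite wP yc -!map_mxM mxE => hy.
have := norm_spectral w; rewrite wP yc -!map_mxM mxE => ny.
have le0 : \sum_i toC (r - D i) * `|w 0 i| ^+ 2 <= 0.
  under eq_bigr do rewrite rmorphB mulrBl.
  by rewrite sumrB -mulr_sumr -ny -hy -rmorphM subr_le0 lecR.
(* A vanishing sum of nonnegative terms: each coordinate w i is zero unless
   D i = r. *)
have term0 i : toC (r - D i) * `|w 0 i| ^+ 2 = 0.
  have ge0 j : 0 <= toC (r - D j) * `|w 0 j| ^+ 2.
    by rewrite mulr_ge0 ?exprn_ge0 // -(rmorph0 toC) lecR subr_ge0.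
  have /eqP : \sum_i toC (r - D i) * `|w 0 i| ^+ 2 = 0.
    by apply/le_anti; rewrite le0 sumr_ge0.
  by rewrite psumr_eq0 // => /allP/(_ i (mem_index_enum _))/eqP.
apply: (@map_mx_inj _ _ toC); rewrite map_mxM map_mxZ -wP A_diag !mulmxA.
rewrite -(mulmxA w) mulmxV // mulmx1 scalemxAl; congr (_ *m P).
apply/rowP => i; rewrite mul_mx_diag !mxE mulrC.
move/eqP: (term0 i); rewrite mulf_eq0 expf_eq0 normr_eq0 /= rmorphB subr_eq0.
by case/orP=> /eqP ->; rewrite ?mulr0.
Qed.

End Diagonalised.

(** The eigenvalues sum to the trace, which is zero, and exactly one of them, r,
    is positive, so their absolute values sum to 2 r.  As r is the largest
    eigenvalue, the entrywise modulus of an eigenvector for r is again an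
    eigenvector for r, and it has no zero entry. *)
Theorem energy_perron :
  (1 < n)%N -> (forall i, A i i = 0) -> (forall i j, i != j -> 0 < A i j) ->
  neg_def_sum0 A ->
  exists (r : R) (y : 'rV[R]_n),
    [/\ 0 < r, energy A = 2 * r, forall i, 0 < y 0 i & y *m A = r *: y].
Proof.
move=> n1 A0 A_gt0 negA.
have A_ge0 i j : 0 <= A i j.
  by have [->|/A_gt0/ltW//] := eqVneq i j; rewrite A0.
have [P [D [uP Pinv A_diag eD]]] := real_sym_spectral.
have sumD : \sum_i D i = 0.
  by rewrite -(trace_spectral uP A_diag) /mxtrace big1.
have [k Dk_ge0] : exists k, 0 <= D k.
  case: (pickP (fun k => 0 <= D k)) => [k Dk|Dlt0]; first by exists k.
  have : \sum_i - D i = 0 by rewrite sumrN sumD oppr0.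
  move=> /eqP; rewrite psumr_eq0 => [|i _]; last first.
    by rewrite oppr_ge0 ltW // ltNge Dlt0.
  move=> /allP/(_ (Ordinal n1) (mem_index_enum _)) /=.
  by rewrite oppr_eq0 => /eqP D0; have := Dlt0 (Ordinal n1); rewrite D0 lexx.
have D_lt0 i : i != k -> D i < 0.
  rewrite ltNge; apply: contra => Di.
  by apply/eqP; apply: (spectral_nonneg_unique uP Pinv A_diag negA).
have Dk : D k = \sum_(i | i != k) - D i.
  by move/eqP: sumD; rewrite (bigD1 k) //= addr_eq0 -sumrN => /eqP.
have Dk_gt0 : 0 < D k.
  have [l lk] := exists_neq k n1.
  rewrite Dk (bigD1 l) //= ltr_wpDr ?oppr_gt0 ?D_lt0 //.
  by apply: sumr_ge0 => i /andP[ik _]; rewrite oppr_ge0 ltW // D_lt0.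
have D_max i : D i <= D k.
  by have [->//|/D_lt0 Di] := eqVneq i k; apply: ltW (lt_trans Di Dk_gt0).
pose y : 'rV[R]_n := \row_i ComplexField.Normc.normc (P k i).
have yE i : toC (y 0 i) = `|P k i| by rewrite mxE.
have y_ge0 i : 0 <= y 0 i by rewrite -lecR yE normr_ge0.
(* The triangle inequality in the eigenvector equation of row k of P. *)
have sub_eigen i : D k * y 0 i <= \sum_j y 0 j * A j i.
  have PA : P *m AC = diag_mx (\row_i toC (D i)) *m P.
    by rewrite A_diag !mulmxA mulmxV // mul1mx.
  rewrite -lecR rmorphM rmorph_sum /= yE -[X in X * _]ger0_norm; last first.
    by rewrite -(rmorph0 toC) lecR.
  rewrite -normrM.
  have -> : toC (D k) * P k i = \sum_j P k j * toC (A j i).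
    move/matrixP/(_ k i): PA; rewrite mul_diag_mx [LHS]mxE [RHS]mxE [X in _ = X * _]mxE => <-.
    by apply: eq_bigr => j _; rewrite [AC j i]mxE.
  apply: le_trans (ler_norm_sum _ _ _) _; apply: ler_sum => j _.
  rewrite normrM rmorphM /= yE [X in _ * X]ger0_norm //.
  by rewrite -(rmorph0 toC) lecR.
have y_eigen : y *m A = D k *: y.
  apply: rayleigh_max_eigenvector uP Pinv A_diag _ _ D_max _.
  rewrite [X in _ * X]mxE mulr_sumr [leRHS]mxE; apply: ler_sum => i _.
  rewrite [y^T i 0]mxE mulrA ler_wpM2r //.
  by rewrite [leRHS]mxE sub_eigen.
exists (D k), y; split=> //.
  rewrite (energy_spectral eD) (bigD1 k) //= ger0_norm //.
  rewrite mulr_natl mulr2n; congr (_ + _).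
  by rewrite [RHS]Dk; apply: eq_bigr => i /D_lt0 Di; rewrite ltr0_norm.
move=> i; rewrite lt_neqAle y_ge0 andbT eq_sym; apply/negP => /eqP yi0.
have y0 j : y 0 j = 0.
  have [->//|ji] := eqVneq j i.
  move/rowP/(_ i): y_eigen; rewrite mxE [RHS]mxE yi0 mulr0 => /eqP.
  rewrite psumr_eq0 => [|l _]; last by rewrite mulr_ge0.
  move=> /allP/(_ j (mem_index_enum _)) /=.
  by rewrite mulf_eq0 (gt_eqF (A_gt0 _ _ ji)) orbF => /eqP.
have Pk0 : delta_mx 0 k *m P = 0 :> 'rV_n.
  apply/rowP => j; rewrite -rowE mxE [RHS]mxE; apply/eqP.
  by rewrite -normr_eq0 -yE y0.
have /rowP/(_ k)/eqP : delta_mx 0 k = 0 :> 'rV[R[i]]_n.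
  by rewrite -(mulmxK uP (delta_mx 0 k)) Pk0 mul0mx.
by rewrite !mxE !eqxx oner_eq0.
Qed.

End RealSymmetric.

(** * The Laplacian of a connected graph and its Moore-Penrose inverse *)

Section Laplacian.
Variables (R : rcfType) (n : nat) (e : rel 'I_n).
Hypothesis e_sym : symmetric e.
Hypothesis e_conn : forall i j : 'I_n, connect e i j.

Local Notation L := (laplacian R e).
Local Notation X := (mpinv L).

Lemma laplacian_tr : L^T = L.
Proof.
rewrite /laplacian linearB /= tr_diag_mx; congr (_ - _).
by apply/matrixP => i j; rewrite !mxE e_sym.
Qed.

Lemma degree_sum i : #|[set j | e i j]|%:R = \sum_j (e i j)%:R :> R.
Proof.
rewrite -sum1_card natr_sum [RHS](bigID (e i)) /= [X in _ + X]big1 ?addr0.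
  by apply: eq_big => j; rewrite ?inE // => ->.
by move=> j /negbTE ->.
Qed.

Lemma laplacian_quad_form (x : 'rV[R]_n) :
  (x *m L *m x^T) 0 0 *+ 2 =
  \sum_i \sum_j (e i j)%:R * (x 0 i - x 0 j) ^+ 2.
Proof.
have -> : (x *m L *m x^T) 0 0 =
    \sum_i \sum_j (e i j)%:R * x 0 i ^+ 2
    - \sum_i \sum_j (e i j)%:R * (x 0 i * x 0 j).
  rewrite /laplacian mulmxBr mulmxBl mxE [in X in _ + X]mxE; congr (_ - _).
    rewrite /degree_mx mul_mx_diag !mxE; apply: eq_bigr => i _.
    by rewrite !mxE degree_sum -big_distrl /= expr2 mulrAC mulrC.
  rewrite quad_form_sum; apply: eq_bigr => i _; apply: eq_bigr => j _.
  by rewrite !mxE -mulrA mulrCA.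
rewrite mulr2n {1}(exchange_big _ _ _ _ _ (fun i j => (e i j)%:R * x 0 i ^+ 2)) /=.
rewrite addrACA -opprD -!big_split -sumrB /=; apply: eq_bigr => i _.
rewrite -!big_split -sumrB /=; apply: eq_bigr => j _.
by rewrite (e_sym j i); ring.
Qed.

Lemma laplacian_psd (x : 'rV[R]_n) : 0 <= (x *m L *m x^T) 0 0.
Proof.
rewrite -(pmulrn_lge0 _ (n := 2)) // laplacian_quad_form.
by apply: sumr_ge0 => i _; apply: sumr_ge0 => j _; rewrite mulr_ge0 ?sqr_ge0.
Qed.

Lemma laplacian_quad_form_eq0 (x : 'rV[R]_n) :
  (x *m L *m x^T) 0 0 = 0 -> forall i j, x 0 i = x 0 j.
Proof.
move=> x0; have edge i j : e i j -> x 0 i = x 0 j.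
  have /eqP := laplacian_quad_form x; rewrite x0 mul0rn eq_sym.
  rewrite psumr_eq0; last first.
    by move=> k _; apply: sumr_ge0 => l _; rewrite mulr_ge0 ?sqr_ge0.
  move=> /allP/(_ i (mem_index_enum _)) /=; rewrite psumr_eq0; last first.
    by move=> l _; rewrite mulr_ge0 ?sqr_ge0.
  move=> /allP/(_ j (mem_index_enum _)) /= + eij.
  by rewrite eij mul1r sqrf_eq0 subr_eq0 => /eqP.
move=> i j; have /connectP[p] := e_conn i j.
elim: p i => [|k p IHp] i /=; first by move=> _ ->.
by case/andP=> /edge -> /IHp; apply.
Qed.

Lemma const_mul_laplacian (c : R) : (const_mx c : 'rV_n) *m L = 0.
Proof.
apply/rowP => j; rewrite /laplacian mulmxBr /degree_mx mul_mx_diag !mxE.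
rewrite degree_sum big_distrr /=; apply/eqP; rewrite subr_eq0; apply/eqP.
by apply: eq_bigr => i _; rewrite !mxE e_sym.
Qed.

Lemma mpinv_laplacian_tr : X^T = X.
Proof.
have /and4P[/eqP LXL /eqP XLX /eqP LXT /eqP XLT] := mpinvP L.
apply: (@moore_penrose_unique _ _ _ L); last exact: mpinvP.
apply/and4P; split; apply/eqP.
- by rewrite -[RHS]laplacian_tr -[in RHS]LXL !trmx_mul laplacian_tr mulmxA.
- by rewrite -[in RHS]XLX !trmx_mul laplacian_tr mulmxA.
- by rewrite trmx_mul trmxK laplacian_tr -[RHS]trmxK trmx_mul trmxK laplacian_tr XLT.
- by rewrite trmx_mul trmxK laplacian_tr -[RHS]trmxK trmx_mul trmxK laplacian_tr LXT.
Qed.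

Lemma mpinv_laplacian_sym i j : X i j = X j i.
Proof. by rewrite -[in LHS]mpinv_laplacian_tr mxE. Qed.

Lemma mpinv_laplacian_comm : X *m L = L *m X.
Proof.
have /and4P[_ _ _ /eqP <-] := mpinvP L.
by rewrite trmx_mul mpinv_laplacian_tr laplacian_tr.
Qed.

(** [X] is positive definite on sum-zero vectors: [x X x^T] is the Laplacian
    form at [x X], so if it vanishes then [x X] is constant, [x L] vanishes, and
    [x] is itself constant. *)
Lemma mpinv_laplacian_gt0 (x : 'rV[R]_n) :
  \sum_i x 0 i = 0 -> x != 0 -> 0 < (x *m X *m x^T) 0 0.
Proof.
move=> sx0 xN0; have /rV0Pn[i0 _] := xN0.
have /and4P[/eqP LXL /eqP XLX _ _] := mpinvP L.
have -> : x *m X *m x^T = (x *m X) *m L *m (x *m X)^T.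
  by rewrite trmx_mul mpinv_laplacian_tr !mulmxA -(mulmxA x X L) -(mulmxA x _ X) XLX.
rewrite lt_neqAle laplacian_psd andbT eq_sym; apply: contra_neqN xN0.
move=> /eqP/laplacian_quad_form_eq0 xXc.
have xX : x *m X = const_mx ((x *m X) 0 i0).
  by apply/rowP => i; rewrite [RHS]mxE; apply: xXc.
have xL0 : x *m L = 0.
  by rewrite -LXL -mpinv_laplacian_comm !mulmxA xX const_mul_laplacian mul0mx.
have xc i : x 0 i = x 0 i0.
  by apply: laplacian_quad_form_eq0; rewrite xL0 mul0mx mxE.
apply/rowP => i; rewrite [RHS]mxE xc; apply/eqP; move/eqP: sx0.
rewrite (eq_bigr _ (fun i _ => xc i)) sumr_const card_ord mulrn_eq0.
by case/orP=> // /eqP n0; have := ltn_ord i0; rewrite [X in (_ < X)%N]n0.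
Qed.

(** * The resistance distance matrix *)

Lemma resistance_mxE (i j : 'I_n) : resistance_mx R e i j = X i i + X j j - X i j *+ 2.
Proof. by rewrite mxE. Qed.

Lemma resistance_mx_tr : (resistance_mx R e)^T = resistance_mx R e.
Proof.
apply/matrixP => i j; rewrite [LHS]mxE !resistance_mxE [X j j + _]addrC.
by rewrite (mpinv_laplacian_sym j).
Qed.

Lemma resistance_mx_diag i : resistance_mx R e i i = 0.
Proof. by rewrite resistance_mxE mulr2n subrr. Qed.

Lemma resistance_mx_gt0 i j : i != j -> 0 < resistance_mx R e i j.
Proof.
(* r_ij is the value of the form of X at the difference of basis vectors. *)
move=> ij; pose x : 'rV[R]_n := delta_mx 0 i - delta_mx 0 j.
have -> : resistance_mx R e i j = (x *m X *m x^T) 0 0.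
  rewrite /x linearB /= !trmx_delta mulmxBl mulmxBr !mulmxBl -!rowE -!colE.
  rewrite resistance_mxE !mxE [X j i]mpinv_laplacian_sym.
ring.
apply: mpinv_laplacian_gt0.
  have sum1 k : \sum_l (l == k)%:R = 1 :> R.
    by rewrite (bigD1 k) //= eqxx big1 ?addr0 // => l /negbTE ->.
  rewrite /x; under eq_bigr do rewrite !mxE !eqxx /=.
  by rewrite sumrB !sum1 subrr.
by apply/eqP => /rowP/(_ i)/eqP; rewrite !mxE !eqxx (negbTE ij) subr0 oner_eq0.
Qed.

(** On sum-zero vectors the terms [X i i + X j j] of the resistance do not
    contribute, leaving minus twice the form of [X]. *)
Lemma resistance_neg_def_sum0 : neg_def_sum0 (resistance_mx R e).
Proof.
move=> x sx0 xN0.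
have -> : (x *m resistance_mx R e *m x^T) 0 0 = - ((x *m X *m x^T) 0 0 *+ 2).
  rewrite !quad_form_sum -sumrMnl -sumrN.
  transitivity (\sum_i \sum_j (x 0 i * X i i * x 0 j + x 0 i * (X j j * x 0 j)
      - (x 0 i * X i j * x 0 j) *+ 2)).
    apply: eq_bigr => i _; apply: eq_bigr => j _; rewrite resistance_mxE.
    by rewrite mulrBr mulrBl mulrDr mulrDl mulrA -mulrnAl -mulrnAr.
  under eq_bigr do rewrite sumrB big_split /= -mulr_sumr sx0 mulr0 add0r -mulr_sumr.
  rewrite sumrB -mulr_suml sx0 mul0r sub0r sumrN; congr (- _).
  by apply: eq_bigr => i _; rewrite sumrMnl.
by rewrite oppr_lt0 pmulrn_lgt0 // mpinv_laplacian_gt0.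
Qed.

End Laplacian.

(** * Bounds on a Perron root by two weighted row averages *)

(** [x p] and [x q] are the two largest values. *)
Lemma two_largest (R : realDomainType) (n : nat) (x : 'I_n -> R) :
  (1 < n)%N -> exists p q : 'I_n,
    [/\ p != q, forall j, j != p -> x j <= x q & forall j, j != q -> x j <= x p].
Proof.
move=> n1; case: (@arg_maxP _ _ _ (Ordinal n1) xpredT x isT) => p _ p_max.
have [l lp] := exists_neq p n1.
case: (@arg_maxP _ _ _ l (fun i => i != p) x lp) => q qp q_max.
by exists p, q; split=> [|j /q_max|j _]; rewrite 1?eq_sym //; apply: p_max.
Qed.

(** A nonnegative matrix [A] with zero diagonal and a positive eigenvector written
    as the entrywise product of the weights [w] and the vector [x]. *)
Section WeightedPerronBounds.
Variables (R : rcfType) (n : nat) (A : 'M[R]_n) (w x : 'I_n -> R) (r : R).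
Hypothesis A_diag0 : forall i, A i i = 0.
Hypothesis A_ge0 : forall i j, 0 <= A i j.
Hypotheses (w_gt0 : forall i, 0 < w i) (x_gt0 : forall i, 0 < x i).
Hypothesis r_gt0 : 0 < r.
Hypothesis eigen : forall i, \sum_j A i j * (w j * x j) = r * (w i * x i).

(* The row sums of A conjugated by the diagonal matrix W of w, W^-1 A W. *)
Let b i := (\sum_j A i j * w j) / w i.

(** As the diagonal of [A] is zero, the value [x i] does not enter the right-hand
    side of the [i]-th eigenvector equation. *)
Lemma weighted_eigen_le (i : 'I_n) (m : R) :
  (forall j, j != i -> x j <= m) -> r * x i <= b i * m.
Proof.
move=> xm; rewrite /b mulrAC ler_pdivlMr // -mulrA [x i * _]mulrC -eigen mulr_suml.
apply: ler_sum => j _; have [->|ji] := eqVneq j i; first by rewrite A_diag0 !mul0r.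
by rewrite mulrA ler_wpM2l ?xm // mulr_ge0 // ltW.
Qed.

Lemma weighted_eigen_ge (i : 'I_n) (m : R) :
  (forall j, j != i -> m <= x j) -> b i * m <= r * x i.
Proof.
move=> xm; rewrite /b mulrAC ler_pdivrMr // -mulrA [x i * _]mulrC -eigen mulr_suml.
apply: ler_sum => j _; have [->|ji] := eqVneq j i; first by rewrite A_diag0 !mul0r.
by rewrite mulrA ler_wpM2l ?xm // mulr_ge0 // ltW.
Qed.

Lemma weighted_avg_ge0 i : 0 <= b i.
Proof.
by rewrite divr_ge0 ?sumr_ge0 // => [j _|]; rewrite ?mulr_ge0 // ltW.
Qed.

(** The two largest values [x p], [x q] give [r x_p <= b_p x_q] and
    [r x_q <= b_q x_p]; multiply. *)
Lemma perron_le_sqrt : (1 < n)%N ->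
  exists p q, p != q /\ r <= Num.sqrt (b p * b q).
Proof.
move=> /(two_largest x)[p [q [pq xq xp]]]; exists p, q; split=> //.
rewrite -[leLHS](ger0_norm (ltW r_gt0)) -sqrtr_sqr; apply: ler_wsqrtr.
have xpq : 0 < x p * x q by rewrite mulr_gt0.
rewrite -(ler_pM2r xpq) expr2 mulrACA [leRHS](_ : _ = (b p * x q) * (b q * x p)).
  by apply: ler_pM; rewrite ?mulr_ge0 ?weighted_eigen_le // ltW.
by rewrite [RHS]mulrACA [x q * _]mulrC.
Qed.

(** The same argument at the two smallest values. *)
Lemma perron_ge_sqrt : (1 < n)%N ->
  exists p q, p != q /\ Num.sqrt (b p * b q) <= r.
Proof.
move=> /(two_largest (fun i => - x i))[p [q [pq xq xp]]]; exists p, q; split=> //.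
rewrite -[leRHS](ger0_norm (ltW r_gt0)) -sqrtr_sqr; apply: ler_wsqrtr.
have xpq : 0 < x p * x q by rewrite mulr_gt0.
rewrite -(ler_pM2r xpq) expr2 [leRHS]mulrACA [leLHS](_ : _ = (b p * x q) * (b q * x p)).
  have bx_ge0 i j : 0 <= b i * x j.
    by apply: mulr_ge0; [exact: weighted_avg_ge0 | exact: ltW].
  apply: ler_pM => //; apply: weighted_eigen_ge => j.
    by move=> /xq; rewrite lerN2.
  by move=> /xp; rewrite lerN2.
by rewrite [RHS]mulrACA [x q * _]mulrC.
Qed.

End WeightedPerronBounds.

(** * Bounds on the resistance energy *)

Unset Implicit Arguments.

Theorem corollary4p4 (R : rcfType) (n : nat) (e : rel 'I_n)
    (n_ge2 : (2 <= n)%N)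
    (e_sym : symmetric e) (e_irr : irreflexive e)
    (e_conn : forall i j : 'I_n, connect e i j) :
  2 * min_offdiag (fun i j : 'I_n =>
        Num.sqrt (avg_resistance_deg R e i * avg_resistance_deg R e j))
    <= resistance_energy R e
  /\
  resistance_energy R e
    <= 2 * max_offdiag (fun i j : 'I_n =>
        Num.sqrt (avg_resistance_deg R e i * avg_resistance_deg R e j)).
Proof.
set A := resistance_mx R e; pose w := resistance_deg R e.
have A_tr : A^T = A by apply: resistance_mx_tr.
have A0 i : A i i = 0 by apply: resistance_mx_diag.
have A_gt0 i j : i != j -> 0 < A i j by apply: resistance_mx_gt0.
have A_ge0 i j : 0 <= A i j.
  by have [->|/A_gt0/ltW//] := eqVneq i j; rewrite A0.
have w_gt0 i : 0 < w i.
  have [j ji] := exists_neq i n_ge2.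
  rewrite /w /resistance_deg (bigD1 j) //= ltr_wpDr ?sumr_ge0 //.
  by rewrite A_gt0 // eq_sym.
have [r [y [r_gt0 energyE y_gt0 yA]]] :=
  energy_perron A_tr n_ge2 A0 A_gt0 (resistance_neg_def_sum0 e_sym e_conn).
(* The weights are the resistance degrees, so that the row averages are the
   average resistance degrees. *)
pose x i := y 0 i / w i.
have x_gt0 i : 0 < x i by rewrite divr_gt0.
have eigen i : \sum_j A i j * (w j * x j) = r * (w i * x i).
  have wx j : w j * x j = y 0 j by rewrite mulrC divfK // gt_eqF.
  rewrite wx; move/rowP/(_ i): yA; rewrite mxE [RHS]mxE => <-.
  by apply: eq_bigr => j _; rewrite wx mulrC -{1}A_tr mxE.
rewrite /resistance_energy -/A energyE; split; rewrite ler_pM2l ?ltr0n //.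
  have [p [q [pq]]] := perron_ge_sqrt A0 A_ge0 w_gt0 x_gt0 r_gt0 eigen n_ge2.
  exact: le_trans (min_offdiag_le _ pq).
have [p [q [pq /le_trans]]] := perron_le_sqrt A0 A_ge0 w_gt0 x_gt0 r_gt0 eigen n_ge2.
by apply; apply: (le_max_offdiag (fun i j => Num.sqrt (_ i * _ j)) pq).
Qed.
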